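(* Let $A$ be a real $m\times n$ matrix and $B$ a real $n\times\rho$ matrix, let $\Theta^{(\kappa)}=\{\Theta^{(\kappa)}_1,\ldots,\Theta^{(\kappa)}_k\}$ be a partition of $\{1,\ldots,n\}$ with $|\Theta^{(\kappa)}|=k$, and let $p=(p_\ell)_{\ell=1}^k$ be the uniform sampling probability, $p_\ell=\frac1k$. Let $c\ge1$ be an integer with $100\le k^{c-1}$, and let $$\hat S=\frac1c\sum_{i=1}^c\frac1{p_{r_i}}A_{(,\Theta^{(\kappa)}_{r_i})}B_{(\Theta^{(\kappa)}_{r_i},)},$$ where $r_1,\ldots,r_c$ are independent samples from $\{1,\ldots,k\}$ drawn according to $p$. Define $s^{(k)}_c\in\mathbb{N}$ by $$s^{(k)}_c=\min_{2\le s\le c}\Big\{s:\ s\ge100\,c\Big(1-F_{\text{b}}\big(s-2;\,c-1,\tfrac1k\big)\Big)\Big\},$$ where $F_{\text{b}}(s;N,\xi)$ is the cumulative distribution function, evaluated at $s$, of the binomial distribution with $N$ trials and success probability $\xi$. Then, with probability at least $0.99$, $$\|\hat S\|_2\le\frac{k\,(s^{(k)}_c-1)}{c}\,\|A\|_2\,\|B\|_2.$$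
   Context: A partition of $\{1,\ldots,n\}$ is into nonempty disjoint blocks $\Theta^{(\kappa)}_\ell$ of indices. $A_{(,\Theta^{(\kappa)}_\ell)}$ is the matrix formed by the columns of $A$ with indices in $\Theta^{(\kappa)}_\ell$, and $B_{(\Theta^{(\kappa)}_\ell,)}$ is the matrix formed by the rows of $B$ with indices in $\Theta^{(\kappa)}_\ell$ (same ordering of indices). $\|\cdot\|_2$ is the spectral norm (operator norm induced by the Euclidean norm). The minimum is over integers $s$ with $2\le s\le c$. *)

(* Defs.v *)
From mathcomp Require Import all_boot all_order all_algebra.
From mathcomp Require Import all_classical all_reals all_analysis.

Set Implicit Arguments.
Unset Strict Implicit.
Unset Printing Implicit Defensive.

Import Order.TTheory GRing.Theory Num.Theory.

Local Open Scope ring_scope.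

Section SpectralNorm.
Context {R : realType}.

Definition euclidean_norm n (x : 'cV[R]_n) : R :=
  Num.sqrt (\sum_(i < n) x i 0 ^+ 2).

Definition spectral_norm m n (A : 'M[R]_(m, n)) : R :=
  sup [set euclidean_norm (A *m x) |
        x in [set x : 'cV[R]_n | euclidean_norm x <= 1]]%classic.

End SpectralNorm.

Section BlockSampling.
Context {R : realType}.

(* Theta enumerates, without repetition, the k blocks of a partition. *)
Definition block_partition n k (Theta : 'I_k -> {set 'I_n}) : Prop :=
  injective Theta /\ finset.partition [set Theta l | l : 'I_k]%SET [set: 'I_n]%SET.

(* enum_val lists the indices of S increasingly, so that the columns of A and
   the rows of B below are taken in the same order. *)
Definition col_block m n (A : 'M[R]_(m, n)) (S : {set 'I_n}) :
  'M[R]_(m, #|S|) := colsub (@enum_val _ (mem S)) A.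

Definition row_block n q (B : 'M[R]_(n, q)) (S : {set 'I_n}) :
  'M[R]_(#|S|, q) := rowsub (@enum_val _ (mem S)) B.

Definition sampled_product m n q k c (A : 'M[R]_(m, n)) (B : 'M[R]_(n, q))
    (Theta : 'I_k -> {set 'I_n}) (p : 'I_k -> R) (r : 'I_c -> 'I_k) :
    'M[R]_(m, q) :=
  c%:R^-1 *: \sum_(i < c)
    (p (r i))^-1 *: (col_block A (Theta (r i)) *m row_block B (Theta (r i))).

End BlockSampling.

(* Random variables with values in a finite type S are taken with respect to the
   discrete sigma-algebra on S; S is not a measurableType because these are
   pointed, whereas 'I_k may be empty. *)
Section FiniteValued.
Context d (T : measurableType d) (R : realType) (P : probability T R).
Context (S : finType).
Local Open Scope classical_set_scope.

Definition finite_random_variable (X : T -> S) : Prop :=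
  forall E : set S, measurable (X @^-1` E).

Definition has_law (X : T -> S) (p : S -> R) : Prop :=
  forall l, P (X @^-1` [set l]) = (p l)%:E.

Definition mutually_independent (I : finType) (X : I -> T -> S) : Prop :=
  forall (J : {set I}) (E : I -> set S),
    P (\bigcap_(i in [set` J]) (X i @^-1` E i)) =
    (\prod_(i in J) P (X i @^-1` E i))%E.

End FiniteValued.

Definition binomial_cdf {R : realType} (s N : nat) (xi : R) : R :=
  fine (binomial_prob N xi [set j : nat | (j <= s)%N]%classic).

(* The minimum of { s | 2 <= s <= c, s >= 100 c (1 - F_b(s-2; c-1, 1/k)) }.
   The default ord_max, i.e. c, is only returned when this set is empty; if
   c >= 2, k >= 1 and 100 <= k ^ (c - 1), the set contains c, because
   1 - F_b(c-2; c-1, 1/k) = (1/k) ^ (c - 1). *)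
Definition s_min (R : realType) (c k : nat) : nat :=
  [arg min_(s < (ord_max : 'I_c.+1) | (2 <= s)%N &&
      (100 * c%:R * (1 - binomial_cdf (s - 2) (c - 1) (1 / k%:R : R))
        <= s%:R)%R) (s : nat)]%N.

(* Main.v *)
Require Import Defs.
From mathcomp Require Import all_boot all_order all_algebra.
From mathcomp Require Import all_classical all_reals all_analysis.
From mathcomp Require Import zify ring lra.

(** The sampled product only rescales the middle index of [A *m B]: the column
    of [A] and the row of [B] with index [j] are weighted by [k / c] times the
    number of draws that hit the block of [j] ([sampled_productE]). Hence its
    spectral norm is at most [k / c] times the largest number [M] of hits of a
    single block, times the norms of [A] and [B] ([spectral_norm_mul_diag]),
    and it suffices to show that [M >= s] has probability at most 1/100, where
    [s] is the threshold [s_min].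

    The [c] draws are uniform on the [k ^ c] functions from draws to blocks, so
    this is a count. Say that a draw is heavy if its block is hit at least [s]
    times. If [M >= s] then at least [s] draws are heavy, while a given draw is
    heavy exactly if at least [s - 1] of the [c - 1] other draws agree with it,
    a binomial tail event with parameters [c - 1] and [1 / k]. By Markov's
    inequality,
      Pr (M >= s) <= (c / s) (1 - F_b (s - 2; c - 1, 1 / k)),
    which is at most 1/100 by the definition of [s]. In [card_overload] this
    appears as a union bound over the blocks, where the passage from [c] to
    [c - 1] trials is the identity
      (i + 1) binom (c, i + 1) = c binom (c - 1, i).
    The hypothesis [100 <= k ^ (c - 1)] makes [s = c] admissible in the
    minimum, so that [s_min] does satisfy its defining inequality
    ([s_min_spec]). *)

Import Order.TTheory GRing.Theory Num.Theory.
Local Open Scope classical_set_scope.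
Local Open Scope ring_scope.

(** * The Euclidean norm *)

Section EuclideanNorm.
Context {R : realType}.

Lemma euclidean_norm_ge0 n (x : 'cV[R]_n) : 0 <= euclidean_norm x.
Proof. exact: sqrtr_ge0. Qed.

Lemma sqr_euclidean_norm n (x : 'cV[R]_n) :
  euclidean_norm x ^+ 2 = \sum_(i < n) x i 0 ^+ 2.
Proof. by rewrite sqr_sqrtr// sumr_ge0// => i _; rewrite sqr_ge0. Qed.

Lemma le_euclidean_norm n (a : R) (x y : 'cV[R]_n) : 0 <= a ->
  (forall i, `|x i 0| <= a * `|y i 0|) ->
  euclidean_norm x <= a * euclidean_norm y.
Proof.
move=> a0 xy; rewrite -(@ler_pXn2r _ 2)// ?nnegrE ?mulr_ge0 ?euclidean_norm_ge0//.
rewrite exprMn !sqr_euclidean_norm mulr_sumr ler_sum// => i _.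
rewrite -[x i 0 ^+ 2]real_normK ?num_real// -[y i 0 ^+ 2]real_normK ?num_real//.
by rewrite -exprMn ler_pXn2r ?nnegrE ?mulr_ge0.
Qed.

Lemma le_coord_euclidean_norm n (x : 'cV[R]_n) i : `|x i 0| <= euclidean_norm x.
Proof.
rewrite -sqrtr_sqr ler_wsqrtr// (bigD1 i)//= lerDl sumr_ge0// => j _.
exact: sqr_ge0.
Qed.

Lemma euclidean_normZ n (a : R) (x : 'cV[R]_n) :
  euclidean_norm (a *: x) = `|a| * euclidean_norm x.
Proof.
rewrite /euclidean_norm -sqrtr_sqr -sqrtrM ?sqr_ge0// mulr_sumr.
by congr Num.sqrt; apply: eq_bigr => i _; rewrite mxE exprMn.
Qed.

Lemma euclidean_norm_eq0 n (x : 'cV[R]_n) : (euclidean_norm x == 0) = (x == 0).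
Proof.
apply/eqP/eqP => [x0|->]; last first.
  by rewrite -(scale0r 0) euclidean_normZ normr0 mul0r.
apply/matrixP => i j; rewrite ord1 mxE; apply/eqP.
by rewrite -normr_le0 -x0 le_coord_euclidean_norm.
Qed.

End EuclideanNorm.

(** * The spectral norm of a product with a diagonal factor *)

Section SpectralNorm.
Context {R : realType}.

(** The supremum of an unbounded set of reals carries no information, so every
    upper estimate by [spectral_norm] rests on this bound. On the unit ball the coordinates of
    [x] are at most 1, so the row sums of absolute values bound those of
    [A *m x]. *)
Lemma has_ubound_spectral_norm m n (A : 'M[R]_(m, n)) :
  has_ubound [set euclidean_norm (A *m x) |
    x in [set x : 'cV[R]_n | euclidean_norm x <= 1]].
Proof.
exists (euclidean_norm (\col_i \sum_j `|A i j|)) => _ [x /= x1 <-].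
rewrite -[leRHS]mul1r; apply: le_euclidean_norm => // i.
rewrite mul1r !mxE (le_trans (ler_norm_sum _ _ _))// ger0_norm ?sumr_ge0//.
apply: ler_sum => j _; rewrite normrM ler_piMr//.
exact: le_trans (le_coord_euclidean_norm _ x j) x1.
Qed.

Lemma le_spectral_norm m n (A : 'M[R]_(m, n)) (x : 'cV[R]_n) :
  euclidean_norm (A *m x) <= spectral_norm A * euclidean_norm x.
Proof.
have [/eqP|x0] := eqVneq (euclidean_norm x) 0.
  rewrite euclidean_norm_eq0 => /eqP ->; rewrite mulmx0.
  by rewrite -(scale0r (0 : 'cV[R]_m)) -(scale0r (0 : 'cV[R]_n)) !euclidean_normZ
    normr0 !mul0r mulr0.
have x_gt0 : 0 < euclidean_norm x by rewrite lt_def x0 euclidean_norm_ge0.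
rewrite -ler_pdivrMr//.
have -> : euclidean_norm (A *m x) / euclidean_norm x =
    euclidean_norm (A *m ((euclidean_norm x)^-1 *: x)).
  by rewrite -scalemxAr euclidean_normZ ger0_norm ?invr_ge0 ?euclidean_norm_ge0// mulrC.
apply: ub_le_sup; first exact: has_ubound_spectral_norm.
exists ((euclidean_norm x)^-1 *: x) => //=.
by rewrite euclidean_normZ ger0_norm ?invr_ge0 ?euclidean_norm_ge0// mulVf.
Qed.

Lemma spectral_norm_ge0 m n (A : 'M[R]_(m, n)) : 0 <= spectral_norm A.
Proof.
apply: ub_le_sup; first exact: has_ubound_spectral_norm.
have zero_norm q : euclidean_norm (0 : 'cV[R]_q) = 0.
  by apply/eqP; rewrite euclidean_norm_eq0.
by exists 0; rewrite /= ?mulmx0 zero_norm.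
Qed.

(** The three factors act on a vector in turn: [B], then [diag_mx e], which
    scales each coordinate, hence the Euclidean norm, by at most [t], and
    then [A]. *)
Lemma spectral_norm_mul_diag m n q (A : 'M[R]_(m, n)) (e : 'rV[R]_n)
    (B : 'M[R]_(n, q)) (t : R) : 0 <= t -> (forall j, `|e 0 j| <= t) ->
  spectral_norm (A *m diag_mx e *m B) <= t * spectral_norm A * spectral_norm B.
Proof.
move=> t0 et; apply: ge_sup.
  by eexists; exists 0 => //=; rewrite (_ : euclidean_norm _ = 0)//;
    apply/eqP; rewrite euclidean_norm_eq0.
move=> _ [x /= x1 <-]; rewrite -!mulmxA.
apply: le_trans (le_spectral_norm _ _ _ _) _.
rewrite [t * _]mulrC -mulrA ler_wpM2l ?spectral_norm_ge0//.
apply: (@le_trans _ _ (t * euclidean_norm (B *m x))).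
  apply: le_euclidean_norm => // i.
  by rewrite mul_diag_mx mxE normrM ler_wpM2r.
rewrite ler_wpM2l// (le_trans (le_spectral_norm _ _ _ _))//.
by rewrite ler_piMr ?spectral_norm_ge0.
Qed.

End SpectralNorm.

(** * The sampled product as a diagonally weighted product *)

Section BlockProduct.
Context {R : realType}.

Lemma mul_col_row_block m n q (A : 'M[R]_(m, n)) (B : 'M[R]_(n, q))
    (S : {set 'I_n}) :
  col_block A S *m row_block B S = A *m diag_mx (\row_j (j \in S)%:R) *m B.
Proof.
apply/matrixP => i j; rewrite mul_mx_diag !mxE.
rewrite (bigID (mem S))/= [X in _ = _ + X]big1 ?addr0; last first.
  by move=> l /negbTE lS; rewrite !mxE lS mulr0 mul0r.
rewrite [RHS](big_enum_val (A := mem S))/=; apply: eq_bigr => l _.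
by rewrite !mxE enum_valP mulr1.
Qed.

(** With [p] uniform every draw carries the same weight [k / c], and a sum of
    diagonal block indicators counts hits. *)
Lemma sampled_productE m n q k c (A : 'M[R]_(m, n)) (B : 'M[R]_(n, q))
    (Theta : 'I_k -> {set 'I_n}) (p : 'I_k -> R) (r : 'I_c -> 'I_k) :
  (forall l, p l = 1 / k%:R) ->
  sampled_product A B Theta p r =
  A *m diag_mx (\row_j (k%:R / c%:R * #|[set i | j \in Theta (r i)]%SET|%:R)) *m B.
Proof.
move=> hp; rewrite /sampled_product.
under eq_bigr => i _ do
  rewrite hp div1r invrK mul_col_row_block scalemxAl scalemxAr.
rewrite -mulmx_suml -mulmx_sumr scalemxAl scalemxAr; congr (_ *m _ *m _).
apply/matrixP => i j; rewrite !mxE summxE.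
under eq_bigr => l _ do rewrite !mxE.
case: eqVneq => [_|_]; last first.
  by rewrite mulr0n big1 ?mulr0// => l _; rewrite mulr0n mulr0.
under eq_bigr => l _ do rewrite mulr1n.
rewrite -mulr_sumr mulr1n mulrA [c%:R^-1 * _]mulrC; congr (_ * _).
by rewrite -sum1dep_card natr_sum [RHS]big_mkcond/=; apply: eq_bigr => l _; case: ifP.
Qed.

(** The draws that hit the block of [j] are the draws of one block label,
    because the blocks are disjoint and listed without repetition. *)
Lemma card_block_hits n k c (Theta : 'I_k -> {set 'I_n}) (r : 'I_c -> 'I_k)
    (s : nat) : block_partition Theta ->
  (forall l, (#|[set i | r i == l]%SET| <= s)%N) ->
  forall j, (#|[set i | j \in Theta (r i)]%SET| <= s)%N.
Proof.
move=> [inj_Theta /and3P[_ /finset.trivIsetP disj_Theta _]] rs j.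
have [->|/finset.set0Pn[i0]] := eqVneq [set i | j \in Theta (r i)]%SET finset.set0.
  by rewrite cards0.
rewrite inE => ji0; rewrite (leq_trans _ (rs (r i0)))// subset_leq_card//.
apply/fintype.subsetP => i; rewrite !inE => ji; apply: contraTT ji => ri.
have /disj_Theta : Theta (r i) \in [set Theta l | l : 'I_k]%SET by apply: imset_f.
move=> /(_ (Theta (r i0))); rewrite imset_f// (inj_eq inj_Theta) ri.
by move=> /(_ isT isT) /disjointFl ->.
Qed.

End BlockProduct.

(** * Counting functions with a large fiber *)

Section Counting.
Context {I K : finType}.
Local Open Scope nat_scope.

Definition fiber (f : {ffun I -> K}) (l : K) : {set I} := [set i | f i == l]%SET.

(** The value is forced on [J], and elsewhere it is any element but [l]. *)
Lemma card_fiber_eq (l : K) (J : {set I}) :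
  #|[set f : {ffun I -> K} | fiber f l == J]%SET| = #|K|.-1 ^ (#|I| - #|J|).
Proof.
transitivity #|family (fun i => if i \in J then pred1 l else predC1 l)|.
  apply: eq_card => f; rewrite inE; apply/eqP/familyP => [<- i|fJ].
    by rewrite inE; case: ifP => fi; rewrite !inE fi.
  apply/setP => i; rewrite inE; have := fJ i.
  by case: ifP => _; rewrite !inE => // /negbTE.
rewrite card_family foldrE big_image /=.
rewrite (bigID (mem J))/= big1 ?mul1n; last first.
  by move=> i iJ; rewrite iJ card1.
rewrite (eq_bigr (fun=> #|K|.-1)); last first.
  by move=> i /negbTE ->; rewrite cardC1.
rewrite prod_nat_const; congr (_ ^ _).
by rewrite -(cardC J) addKn; apply: eq_card => i; rewrite !inE.
Qed.

Lemma card_fiber_size (l : K) (j : nat) :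
  #|[set f : {ffun I -> K} | #|fiber f l| == j]%SET| =
  'C(#|I|, j) * #|K|.-1 ^ (#|I| - j).
Proof.
rewrite -sum1dep_card (partition_big (fun f => fiber f l) (fun J => #|J| == j))//=.
rewrite -card_draws -sum1dep_card big_distrl/=; apply: eq_bigr => J /eqP Jj.
rewrite mul1n -{2}Jj -(card_fiber_eq l) -sum1dep_card.
by apply: eq_bigl => f; have [->|] := eqVneq (fiber f l) J; rewrite ?Jj ?eqxx ?andbF.
Qed.

Lemma card_heavy_fiber (l : K) (s : nat) :
  #|[set f : {ffun I -> K} | s <= #|fiber f l|]%SET| =
  \sum_(j < #|I|.+1 | s <= j) 'C(#|I|, j) * #|K|.-1 ^ (#|I| - j).
Proof.
rewrite -sum1dep_card.
rewrite (partition_big (fun f : {ffun I -> K} => inord #|fiber f l| : 'I_#|I|.+1)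
  (fun j : 'I_#|I|.+1 => s <= j))/=; last first.
  by move=> f; rewrite inordK// ltnS max_card.
apply: eq_bigr => j sj; rewrite -(card_fiber_size l) -sum1dep_card.
apply: eq_bigl => f; rewrite -val_eqE/= inordK ?ltnS ?max_card//.
by have [->|] := eqVneq #|fiber f l| j; rewrite ?sj ?andbF.
Qed.

(** The counting form of the Markov bound on the number of heavy indices. The
    factor [s] on the left is absorbed by [s <= i.+1] in each term of the union
    bound, after which [i.+1 * 'C(#|I|, i.+1) = #|I| * 'C(#|I|.-1, i)] trades
    one trial for the factor [#|I|]. *)
Lemma card_overload (s : nat) : 0 < s ->
  s * #|[set f : {ffun I -> K} | [exists l, s <= #|fiber f l|]]%SET| <=
  #|K| * #|I| * \sum_(i < #|I| | s.-1 <= i)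
    'C(#|I|.-1, i) * #|K|.-1 ^ (#|I|.-1 - i).
Proof.
move=> s0.
pose bad l := [set f : {ffun I -> K} | s <= #|fiber f l|]%SET.
have card_bad l : s * #|bad l| <= #|I| * \sum_(i < #|I| | s.-1 <= i)
    'C(#|I|.-1, i) * #|K|.-1 ^ (#|I|.-1 - i).
  (* Fiber sizes start at s > 0, so they are shifted to j = i.+1. *)
  rewrite card_heavy_fiber big_mkcond big_ord_recl leqn0 gtn_eqF//= add0n.
  rewrite -big_mkcond/= !big_distrr/=.
  rewrite (eq_bigl (fun i : 'I_#|I| => s.-1 <= i)); last first.
    by move=> i; rewrite /bump add1n -{1}(prednK s0) ltnS.
  apply: leq_sum => i si; rewrite /bump leq0n add1n.
  rewrite mulnA mulnA mul_bin_diag.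
  rewrite -[#|I|.-1]subn1 -subnDA add1n.
  by rewrite !leq_mul2r; apply/orP; right; apply/orP; right;
    rewrite -(prednK s0) ltnS.
apply: (@leq_trans (s * \sum_l #|bad l|)).
  rewrite leq_mul2l; apply/orP; right.
  rewrite (_ : finset _ = \bigcup_l bad l)%SET; last first.
    by apply/setP => f; rewrite inE; apply/existsP/bigcupP => [[l sl]|[l _ sl]];
      exists l => //; rewrite inE in sl *.
  by apply: (big_ind2 (fun (X : {set _}) n => #|X| <= n)) => //=;
    rewrite ?cards0// => X x Y y Xx Yy; rewrite (leq_trans (leq_card_setU _ _).1)// leq_add.
rewrite big_distrr/= -mulnA -sum_nat_const; exact: leq_sum.
Qed.

End Counting.

(** * From probabilities to counts *)

Section Probability.
Context {R : realType}.

Lemma prob_finite_valued d (T : measurableType d) (P : probability T R)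
    (S : finType) (X : T -> S) (w : R) (Q : {set S}) :
  (forall x, measurable (X @^-1` [set x])) ->
  (forall x, P (X @^-1` [set x]) = w%:E) ->
  P [set t | X t \in Q] = (#|Q|%:R * w)%:E.
Proof.
move=> mX PX.
rewrite (_ : [set t | X t \in Q] = \bigcup_(x in [set` Q]) (X @^-1` [set x])).
  rewrite measure_fin_bigcup//=; last first.
  - by move=> x y _ _ [t [/= -> ->]].
  rewrite (eq_fsbigr (fun=> w%:E)); last by move=> x _; exact: PX.
  rewrite -(bigfs _ _ (r := index_enum S) (P := mem Q)) ?index_enum_uniq//=; last first.
    by move=> x _; rewrite mem_index_enum.
  by rewrite sumEFin sumr_const mulr_natl.
by apply/seteqP; split=> [t Qt|t [x Qx /= ->]]//; exists (X t).
Qed.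

Lemma mutual_independence_joint_law d (T : measurableType d) (P : probability T R)
    (I K : finType) (r : I -> T -> K) (p : K -> R) (f : {ffun I -> K}) :
  mutually_independent P r -> (forall i, has_law P (r i) p) ->
  P ((fun t => [ffun i => r i t]) @^-1` [set f]) = (\prod_i p (f i))%:E.
Proof.
move=> r_indep r_law.
transitivity (\prod_(i in [set: I]%SET) P (r i @^-1` [set f i]))%E.
  rewrite -(r_indep _ (fun i => [set f i])); congr (P _).
  apply/seteqP; split=> [t /= <- i _ /=|t /= rt]; first by rewrite ffunE.
  by apply/ffunP => i; rewrite ffunE; apply: rt; rewrite /= inE.
rewrite -prodEFin; under eq_bigr => i _ do rewrite r_law.
by apply: eq_bigl => i; rewrite inE.
Qed.

Lemma measurable_finfun_preimage d (T : measurableType d) (I K : finType)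
    (r : I -> T -> K) (f : {ffun I -> K}) :
  (forall i, finite_random_variable (r i)) ->
  measurable ((fun t => [ffun i => r i t]) @^-1` [set f]).
Proof.
move=> r_rv.
rewrite (_ : _ @^-1` _ = \bigcap_(i in [set: I]) (r i @^-1` [set f i])).
  by apply: fin_bigcap_measurable => // i _; exact: r_rv.
apply/seteqP; split=> [t /= <- i _ /=|t /= rt]; first by rewrite ffunE.
by apply/ffunP => i; rewrite ffunE; exact: rt.
Qed.

(** With success probability [1 / k] every binomial weight is an integer over
    [k ^ N]; this is the form in which the tail meets [card_overload]. *)
Lemma binomial_upper_tail (N k s : nat) : (0 < k)%N ->
  (k ^ N)%:R * (1 - binomial_cdf s N (1 / k%:R : R)) =
  (\sum_(i < N.+1 | (s < i)%N) 'C(N, i) * k.-1 ^ (N - i))%N%:R.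
Proof.
move=> k0.
have kR : k%:R != 0 :> R by rewrite pnatr_eq0 -lt0n.
have p0 : 0 <= 1 / k%:R :> R by rewrite divr_ge0.
have p1 : (NngNum p0)%:num <= 1 :> R.
  by rewrite /= ler_pdivrMr ?ltr0n// mul1r ler1n.
have term (i : 'I_N.+1) : (k ^ N)%:R * binomial_pmf N (1 / k%:R : R) i =
    ('C(N, i) * k.-1 ^ (N - i))%N%:R.
  rewrite /binomial_pmf.
  have -> : unstable.onem (1 / k%:R) = k.-1%:R / k%:R :> R.
    by rewrite /unstable.onem -subn1 natrB// mulrBl mulfV.
  have -> : (k ^ N = k ^ i * k ^ (N - i))%N by rewrite -expnD subnKC// -ltnS.
  rewrite !natrM !natrX !expr_div_n expr1n -mulr_natl.
  by field; rewrite mulr1 !expf_neq0.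
rewrite /binomial_cdf (binomial_probE _ p1).
rewrite (eq_bigr (fun i : 'I_N.+1 => (binomial_pmf N (1 / k%:R) i * (i <= s)%N%:R)%:E)); last first.
  move=> i _; rewrite diracE EFinM; congr (_ * (_ : bool)%:R%:E)%E.
  by apply/idP/idP => [/set_mem|i_s]; last exact: mem_set.
rewrite sumEFin /=.
(* The weights sum to 1, so the complement of the cdf is termwise. *)
have tot : 1 = \sum_(i < N.+1) binomial_pmf N (1 / k%:R : R) i.
  have : binomial_prob N (1 / k%:R : R) setT = 1%:E by exact: probability_setT.
  rewrite (binomial_probE _ p1).
  rewrite (eq_bigr (fun i : 'I_N.+1 => (binomial_pmf N (1 / k%:R) i)%:E)); last first.
    by move=> i _; rewrite diracE mem_setT mule1.
  by rewrite sumEFin => tot1; rewrite (EFin_inj tot1).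
rewrite [X in X - _]tot -sumrB mulr_sumr natr_sum [RHS]big_mkcond/=.
apply: eq_bigr => i _; rewrite -{1}[binomial_pmf _ _ _]mulr1 -mulrBr mulrA term.
by rewrite ltnNge; case: (i <= s)%N; rewrite /= ?subrr ?mulr0 ?subr0 ?mulr1.
Qed.

End Probability.

(** * The threshold and the norm bound *)

(** The minimum defining [s_min] ranges over a nonempty set: at [s = c] the tail
    is the single probability [(1 / k) ^ (c - 1) <= 1 / 100], so that
    [100 * c] times the tail is at most [c]. *)
Lemma s_min_spec (R : realType) (c k : nat) :
  (1 < c)%N -> (0 < k)%N -> (100 <= k ^ (c - 1))%N ->
  (2 <= s_min R c k)%N /\
  100 * c%:R * (1 - binomial_cdf (s_min R c k - 2) (c - 1) (1 / k%:R : R))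
    <= (s_min R c k)%:R.
Proof.
move=> c1 k0 hkc; rewrite /s_min; case: arg_minnP => [|s /andP[s2 s_tail] _]; last by split.
rewrite c1/=.
have kc : 0 < (k ^ (c - 1))%:R :> R by rewrite ltr0n expn_gt0 k0.
have : (k ^ (c - 1))%:R * (1 - binomial_cdf (c - 2) (c - 1) (1 / k%:R : R)) = 1.
  rewrite binomial_upper_tail//.
  rewrite (big_pred1 ord_max) => [|i]; first by rewrite /= binn subnn mul1n.
  by apply/idP/eqP => [ci|->]/=; [apply/val_inj => /=; have := ltn_ord i|]; lia.
set x := 1 - _ => kx.
have hk : 100 <= (k ^ (c - 1))%:R :> R by rewrite (ler_nat _ 100).
have x0 : 0 < x by rewrite -(pmulr_rgt0 _ kc) kx.
by rewrite mulrAC ger_pMl ?ltr0n 1?ltnW// -[leRHS]kx ler_pM2r.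
Qed.

Theorem proposition2p9 (R : realType) (m n rho k c : nat)
  (A : 'M[R]_(m, n)) (B : 'M[R]_(n, rho))
  (Theta : 'I_k -> {set 'I_n}) (hTheta : block_partition Theta)
  (p : 'I_k -> R) (hp : forall l, p l = 1 / k%:R)
  (hc : (1 <= c)%N) (hkc : (100 <= k ^ (c - 1))%N)
  (d : measure_display) (T : measurableType d) (P : probability T R)
  (r : 'I_c -> T -> 'I_k)
  (r_rv : forall i, finite_random_variable (r i))
  (r_indep : mutually_independent P r)
  (r_law : forall i, has_law P (r i) p) :
  ((99 / 100)%:E <=
   P [set w | (spectral_norm (sampled_product A B Theta p (fun i => r i w)) <=
        k%:R * ((s_min R c k)%:R - 1) / c%:R
          * spectral_norm A * spectral_norm B)%R])%E.
Proof.
(* For c = 1, or k = 0, the power k ^ (c - 1) is below 100. *)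
have c1 : (1 < c)%N.
  by case: c hc hkc {r r_rv r_indep r_law} => [|[|]]//; rewrite subnn expn0.
have k0 : (0 < k)%N.
  by case: k hkc {Theta hTheta p hp r r_rv r_indep r_law} => [|]//; rewrite exp0n// subn_gt0.
have [s2 s_tail] := s_min_spec R _ _ c1 k0 hkc.
move: s_tail s2; set s := s_min R c k => s_tail s2.
pose bound (f : {ffun 'I_c -> 'I_k}) :=
  spectral_norm (sampled_product A B Theta p f) <=
  k%:R * (s%:R - 1) / c%:R * spectral_norm A * spectral_norm B.
(* The deterministic part: without a block hit s times, the bound holds. *)
have light_bound f : ~~ [exists l, s <= #|fiber f l|]%N -> bound f.
  rewrite negb_exists => /forallP light.
  rewrite /bound sampled_productE//; apply: spectral_norm_mul_diag.
    by rewrite divr_ge0// mulr_ge0// subr_ge0 ler1n ltnW.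
  move=> j; rewrite mxE ger0_norm ?mulr_ge0 ?divr_ge0// mulrAC ler_wpM2r ?invr_ge0//.
  rewrite ler_wpM2l// lerBrDr natr1 ler_nat.
  apply: (@leq_ltn_trans s.-1); last by rewrite prednK// ltnW.
  apply: card_block_hits hTheta _ j => l.
  by rewrite leqNgt -ltnS prednK ?(ltnW s2)//; exact: light.
(* The event depends on w only through the function of draws. Counting it
   exactly makes its measurability a matter of finitely many values. *)
rewrite (_ : [set w | _] =
    [set w | [ffun i => r i w] \in [set f | bound f]%SET]); last first.
  have rE w : [ffun i => r i w] = (fun i => r i w) :> ('I_c -> 'I_k).
    by apply/funext => i; rewrite ffunE.
  by apply/seteqP; split=> w /=; rewrite inE /bound rE.
rewrite (@prob_finite_valued _ _ _ P _ _ (k%:R^-1 ^+ c)); last 2 first.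
- by move=> f; exact: measurable_finfun_preimage.
- move=> f; rewrite (@mutual_independence_joint_law _ _ _ _ _ _ _ p)//.
  by under eq_bigr do rewrite hp div1r; rewrite prodr_const card_ord.
rewrite lee_fin exprVn -natrX ler_pdivlMr ?ltr0n ?expn_gt0 ?k0//.
pose overloaded := [set f : {ffun 'I_c -> 'I_k} | [exists l, s <= #|fiber f l|]%N]%SET.
have card_bound : (k ^ c <= #|[set f | bound f]%SET| + #|overloaded|)%N.
  rewrite -{1}(card_ord k) -{1}(card_ord c) -card_ffun -(cardC [set f | bound f]%SET).
  rewrite leq_add2l subset_leq_card//; apply/fintype.subsetP => f; rewrite !inE.
  by apply: contraR; exact: light_bound.
have card_overloaded : 100 * #|overloaded|%:R <= (k ^ c)%:R :> R.
  have := @card_overload 'I_c 'I_k s (ltnW s2); rewrite !card_ord -/overloaded => overload.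
  have := @binomial_upper_tail R (c - 1) k (s - 2) k0.
  rewrite subn1 prednK ?(ltnW c1)//.
  rewrite (eq_bigl (fun i : 'I_c => s.-1 <= i)%N); last first.
    by move=> i; lia.
  move=> tail; rewrite -(ler_nat R) !natrM -tail in overload.
  have sR : 0 < s%:R :> R by rewrite ltr0n ltnW.
  rewrite -(ler_pM2l sR) mulrCA.
  have -> : (k ^ c)%:R = k%:R * (k ^ c.-1)%:R :> R.
    by rewrite -natrM -expnS prednK// ltnW.
  have kk : 0 <= k%:R * (k ^ c.-1)%:R :> R by rewrite mulr_ge0.
  rewrite subn1 in s_tail; have := ler_wpM2l kk s_tail.
  lra.
rewrite -(ler_nat R) natrD in card_bound.
lra.
Qed.
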